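(* Let $k\ge 1$ be an integer. Every digraph $D\in D(k,k)$ with $m$ edges has a subgraph belonging to $D(k-1,k-1)$ with at least $(2k-1)m/(2k+1)$ edges.
   Context: All digraphs are finite, without loops and without parallel edges. For integers $k,\ell\ge 0$, $D(k,\ell)$ denotes the family of digraphs in which every vertex $v$ satisfies $d^-(v)\le k$ or $d^+(v)\le \ell$ (indegree at most $k$ or outdegree at most $\ell$). A subgraph of $D$ here means a digraph on vertex set $V(D)$ whose edge set is a subset of $E(D)$. *)

(* Defs.v *)
From mathcomp Require Import all_boot.

Set Implicit Arguments.
Unset Strict Implicit.
Unset Printing Implicit Defensive.

(* An edge u -> v is the ordered pair (u, v). Edges form a set of pairs, so
   there are no parallel edges; the opposite edges (u, v) and (v, u) are not
   parallel and may both be present. *)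
Record digraph (V : finType) := Digraph {
  edges : {set V * V};
  loopless : forall v : V, (v, v) \notin edges
}.

Definition indegree (V : finType) (D : digraph V) (v : V) : nat :=
  #|[set u : V | (u, v) \in edges D]|.

Definition outdegree (V : finType) (D : digraph V) (v : V) : nat :=
  #|[set u : V | (v, u) \in edges D]|.

Definition in_D (k l : nat) (V : finType) (D : digraph V) : Prop :=
  forall v : V, indegree D v <= k \/ outdegree D v <= l.

Definition subgraph (V : finType) (H D : digraph V) : Prop :=
  edges H \subset edges D.

(* Main.v *)
(** Call a vertex tight when both of its degrees are at least [k]; then one of
    them equals [k], and deleting any one edge counted by that degree repairs
    it.  Repairing the tight vertices one by one costs one edge each, which is
    too much only because of vertices with both degrees equal to [k]; so some
    deletions must repair more than one vertex per edge.

    First take a maximal matching of edges [u -> v] with [outdeg u = k] and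
    [indeg v = k]: one edge repairs two vertices.  Then, among the remaining
    tight vertices, take a maximal packing of stars: two edges leaving a vertex
    of outdegree [k + 1] towards two vertices of indegree [k], or the reverse of
    this; two edges repair three vertices.  The rest is repaired one by one.
    Let [c] be the number of remaining vertices with both degrees equal to [k].
    Maximality leaves few possible sources for the edges entering the remaining
    vertices of indegree [k].  Counting these edges, and dually those leaving
    the remaining vertices of outdegree [k], bounds [2 k c] by a sum of local
    terms that are paid for by the degrees. *)

Require Import Defs.
From mathcomp Require Import all_boot all_order all_algebra.
From mathcomp Require Import zify lra.

Set Implicit Arguments.
Unset Strict Implicit.
Unset Printing Implicit Defensive.

(** * Degrees of a relation, double counting and deletion of edges *)

Section Relations.

Variable V : finType.
Implicit Types (e : rel V) (F G : {set V * V}) (X : {set V}) (v w : V).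

(** Reversal lets each fact on outdegrees yield its dual; the charge bound below is applied to both
    [e] and [conv e]. *)
Definition conv (e : rel V) : rel V := fun x y => e y x.

Definition outdeg (e : rel V) (v : V) : nat := #|[set w | e v w]|.

Definition indeg (e : rel V) (v : V) : nat := outdeg (conv e) v.

Definition outdeg_to (e : rel V) (X : {set V}) (v : V) : nat :=
  #|[set w in X | e v w]|.

Definition remove (e : rel V) (F : {set V * V}) : rel V :=
  fun x y => e x y && ((x, y) \notin F).

Lemma outdeg_to_le e X v : outdeg_to e X v <= outdeg e v.
Proof. by apply/subset_leq_card/subsetP => w; rewrite !inE => /andP[]. Qed.

Lemma outdeg_to_lt e (X : {set V}) v w :
  e v w -> w \notin X -> outdeg_to e X v < outdeg e v.
Proof.
move=> evw wX; apply/proper_card/properP; split.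
  by apply/subsetP => x; rewrite !inE => /andP[].
by exists w; rewrite !inE ?evw // (negbTE wX).
Qed.

Lemma sum_outdeg_to e (X : {set V}) :
  \sum_v outdeg_to e X v = \sum_(w in X) indeg e w.
Proof.
transitivity (\sum_v \sum_(w in X) (e v w : nat)).
  apply: eq_bigr => v _; rewrite /outdeg_to -sum1_card big_mkcond /=.
  rewrite [RHS]big_mkcond /=; apply: eq_bigr => w _.
  by rewrite inE; case: (w \in X); case: (e v w).
rewrite exchange_big; apply: eq_bigr => w _ /=.
rewrite /indeg /outdeg -sum1_card [RHS]big_mkcond /=; apply: eq_bigr => v _.
by rewrite inE /conv; case: (e v w).
Qed.

Lemma sum_outdeg (E : {set V * V}) :
  \sum_v outdeg (fun x y => (x, y) \in E) v = #|E|.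
Proof.
rewrite -[RHS]sum1_card [RHS]big_mkcond.
rewrite (eq_bigr (fun p : V * V => ((p.1, p.2) \in E : nat))); last first.
  by move=> [x y] _ /=; case: (_ \in E).
rewrite -(pair_bigA _ (fun x y => ((x, y) \in E : nat))) /=.
apply: eq_bigr => v _; rewrite /outdeg -sum1_card big_mkcond /=.
by apply: eq_bigr => w _; rewrite inE; case: (_ \in E).
Qed.

Lemma sum_indeg e : \sum_v indeg e v = \sum_v outdeg e v.
Proof.
transitivity (\sum_(v in setT) indeg e v).
  by apply: eq_bigl => v; rewrite inE.
rewrite -sum_outdeg_to; apply: eq_bigr => v _.
by apply: eq_card => w; rewrite !inE.
Qed.

Lemma outdeg_remove_leq e F G v :
  F \subset G -> outdeg (remove e G) v <= outdeg (remove e F) v.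
Proof.
move=> /subsetP FG; apply/subset_leq_card/subsetP => w.
rewrite !inE /remove => /andP[-> /=]; exact/contra/FG.
Qed.

Lemma outdeg_remove_card e F (S : {set V}) v :
  (forall w, w \in S -> e v w /\ (v, w) \in F) ->
  outdeg (remove e F) v + #|S| <= outdeg e v.
Proof.
move=> hS; have dis : [disjoint [set w | remove e F v w] & S].
  rewrite disjoint_sym disjoint_subset; apply/subsetP => w /hS [_ vwF].
  by rewrite !inE /remove vwF andbF.
rewrite /outdeg -cardsUI (eqP (_ : _ :&: _ == set0)) ?setI_eq0 //.
rewrite cards0 addn0; apply/subset_leq_card/subsetP => w.
by rewrite !inE => /orP[/andP[]|/hS[]].
Qed.

Definition swap_pairs (F : {set V * V}) : {set V * V} :=
  [set p | (p.2, p.1) \in F].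

Lemma indeg_remove e F v :
  indeg (remove e F) v = outdeg (remove (conv e) (swap_pairs F)) v.
Proof.
by rewrite /indeg /outdeg; apply: eq_card => w; rewrite !inE /conv /remove inE.
Qed.

Lemma indeg_remove_card e F (S : {set V}) v :
  (forall w, w \in S -> e w v /\ (w, v) \in F) ->
  indeg (remove e F) v + #|S| <= indeg e v.
Proof.
move=> hS; rewrite indeg_remove; apply: outdeg_remove_card => w /hS.
by rewrite inE.
Qed.

Lemma indeg_remove_leq e F G v :
  F \subset G -> indeg (remove e G) v <= indeg (remove e F) v.
Proof.
move=> /subsetP FG; rewrite !indeg_remove; apply: outdeg_remove_leq.
by apply/subsetP => p; rewrite !inE; apply: FG.
Qed.

End Relations.

(** * Arithmetic of the local inequalities *)

(** Let one degree be [k] and the other [k + b]. For [b = 0] the last term gives equality, and for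
    [b = 1] there is equality without any charge. From [b = 2] on, [6k + 3b <= 6kb] leaves room for
    the charge [b]; hence the threshold [k.+2]. *)
Lemma unrepaired_charge_le k i o :
  0 < k -> k <= i -> k <= o -> (i == k) || (o == k) ->
  k * k.*2.+1 * 6 +
    3 * ((if (i == k) && (k.+2 <= o) then o - k else 0) +
         (if (o == k) && (k.+2 <= i) then i - k else 0)) <=
  6 * k * (o + i) + 6 * k * ((i == k) && (o == k)).
Proof.
move=> k0 /subnKC <- /subnKC <-; move: (i - k) (o - k) => a b.
have eqk c : (k + c == k) = (c == 0) by lia.
rewrite -[k.+2]addn2 !leq_add2l !addKn !eqk.
case/orP => /eqP ->; rewrite ?andbF ?andbT /= ?addn0.
  case: ltnP => h /=; first by rewrite ?andbF; case: eqP; nia.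
  by case: b h => [|[|[]]] //= _; nia.
case: ltnP => h /=; first by rewrite ?andbF; case: eqP; nia.
by case: a h => [|[|[]]] //= _; nia.
Qed.

(** Weight 4 instead of 6 leaves room for a charge equal to a whole degree above [k]. Equality
    occurs for [k = 1] with degrees 1 and 2. *)
Lemma star_charge_le k i o :
  0 < k -> k <= i -> k <= o -> (i == k) || (o == k) ->
  k * k.*2.+1 * 4 +
    3 * ((if o == k then 0 else o) + (if i == k then 0 else i)) <=
  6 * k * (o + i).
Proof.
move=> k0 /subnKC <- /subnKC <-; move: (i - k) (o - k) => a b.
have eqk c : (k + c == k) = (c == 0) by lia.
rewrite !eqk.
case/orP => /eqP -> /=; rewrite ?addn0.
- by case: eqP => [->|h]; nia.
- by case: eqP => [->|h]; nia.
Qed.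

(** For [k = i = o = 1] the bound is an equality at [g = 1] and fails at [g = 2], so the strict
    inequality on [g] matters. *)
Lemma matching_charge_le k i o g :
  0 < k -> k <= i -> k <= o -> g < o + i ->
  k * k.*2.+1 * 3 + 3 * g <= 6 * k * (o + i).
Proof.
move=> k0 hi ho hg.
have : k.*2.-1 * k.*2 <= k.*2.-1 * (o + i) by rewrite leq_mul2l; lia.
by nia.
Qed.

(** * Criteria for repair, and the charge bound *)

Section Repair.

Variables (V : finType) (k : nat).
Hypothesis k_gt0 : 0 < k.
Implicit Types (F G : {set V * V}) (u v w x y : V).

Definition in_eq (e : rel V) (U : {set V}) : {set V} :=
  [set v in U | indeg e v == k].

Definition out_eq (e : rel V) (U : {set V}) : {set V} :=
  [set v in U | outdeg e v == k].

Definition tight (e : rel V) : {set V} :=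
  [set v | (k <= indeg e v) && (k <= outdeg e v)].

Definition repaired (e : rel V) (F : {set V * V}) (v : V) : bool :=
  (indeg (remove e F) v < k) || (outdeg (remove e F) v < k).

Lemma repaired_mono (e : rel V) F G v :
  F \subset G -> repaired e F v -> repaired e G v.
Proof.
move=> FG /orP[h|h]; apply/orP; [left|right]; apply: leq_ltn_trans h.
- exact: indeg_remove_leq.
- exact: outdeg_remove_leq.
Qed.

Lemma repaired_head (e : rel V) F u v :
  e u v -> (u, v) \in F -> indeg e v = k -> repaired e F v.
Proof.
move=> euv uvF hv; have := @indeg_remove_card _ e F [set u] v.
rewrite cards1 hv /repaired => h; apply/orP; left.
by rewrite -addn1; apply: h => w /set1P ->.
Qed.

Lemma repaired_tail (e : rel V) F u v :
  e u v -> (u, v) \in F -> outdeg e u = k -> repaired e F u.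
Proof.
move=> euv uvF hu; have := @outdeg_remove_card _ e F [set v] u.
rewrite cards1 hu /repaired => h; apply/orP; right.
by rewrite -addn1; apply: h => w /set1P ->.
Qed.

Lemma repaired_out_star (e : rel V) F v x y :
  x != y -> e v x -> e v y -> (v, x) \in F -> (v, y) \in F ->
  outdeg e v = k.+1 -> repaired e F v.
Proof.
move=> xy evx evy vxF vyF hv; have := @outdeg_remove_card _ e F [set x; y] v.
rewrite cards2 xy hv /repaired => h; apply/orP; right.
suff : outdeg (remove e F) v + 2 <= k.+1 by lia.
by apply: h => w /set2P[] ->.
Qed.

Lemma repaired_in_star (e : rel V) F v x y :
  x != y -> e x v -> e y v -> (x, v) \in F -> (y, v) \in F ->
  indeg e v = k.+1 -> repaired e F v.
Proof.
move=> xy evx evy vxF vyF hv; have := @indeg_remove_card _ e F [set x; y] v.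
rewrite cards2 xy hv /repaired => h; apply/orP; left.
suff : indeg (remove e F) v + 2 <= k.+1 by lia.
by apply: h => w /set2P[] ->.
Qed.

(** [U] is the set of unrepaired vertices, [P] and [Q] are those covered by the
    matching and by the stars, [e] is either the graph or its reverse. *)
Definition charge (e : rel V) (U Q : {set V}) (v : V) : nat :=
  if v \in U then
    if (indeg e v == k) && (k.+2 <= outdeg e v) then outdeg e v - k else 0
  else if v \in Q then if outdeg e v == k then 0 else outdeg e v
  else outdeg_to e (in_eq e U) v.

(** The [k * #|X|] edges entering [X], the vertices of [U] of indegree [k], are grouped by their
    tails. A tail in [X :\: Y] may absorb [k] of them, which cancels the contribution of [X :\: Y]
    and leaves that of [X :&: Y]; the excess at each tail is its charge. *)
Lemma charge_bound e (U Q : {set V}) :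
  U \subset tight e ->
  (forall v, v \in U -> (indeg e v == k) || (outdeg e v == k)) ->
  (forall u v, u \in out_eq e (U :|: Q) -> v \in in_eq e U -> ~~ e u v) ->
  (forall u, u \in U -> outdeg e u = k.+1 -> outdeg_to e (in_eq e U) u <= 1) ->
  k * #|in_eq e U :&: out_eq e U| <= \sum_v charge e U Q v.
Proof.
move=> /subsetP UT Umin hmatch hstar.
set X := in_eq e U; set Y := out_eq e U.
have out0 u : u \in U :|: Q -> outdeg e u = k -> outdeg_to e X u = 0.
  move=> uUQ hu; apply/eqP; rewrite cards_eq0 -subset0.
  apply/subsetP => v; rewrite inE => /andP[vX euv]; move: (hmatch u v).
  by rewrite inE uUQ hu eqxx euv => /(_ isT vX).
have sumX : k * #|X| = \sum_u outdeg_to e X u.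
  rewrite sum_outdeg_to mulnC -sum_nat_const; apply: eq_bigr => v.
  by rewrite inE => /andP[_ /eqP].
have sumD : k * #|X :\: Y| = \sum_u k * (u \in X :\: Y).
  by rewrite -big_distrr /= -sum1_card big_mkcond /=; congr (k * _);
     apply: eq_bigr => u _; case: (u \in _).
have := cardsID Y X => hID.
suff : k * #|X| <= \sum_v charge e U Q v + k * #|X :\: Y| by nia.
rewrite sumX sumD -big_split /=; apply: leq_sum => u _.
rewrite /charge; case: ifP => uU; last first.
  case: ifP => uQ; last exact: leq_addr.
  case: eqP => hu; first by rewrite out0 // inE uQ orbT.
  by apply: leq_trans (leq_addr _ _); apply: outdeg_to_le.
have := UT u uU; rewrite inE => /andP[hi ho].
have [hu|hu] := eqVneq (outdeg e u) k; first by rewrite out0 // inE uU.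
have hin : indeg e u == k by move: (Umin u uU); rewrite (negbTE hu) orbF.
have -> : u \in X :\: Y by rewrite !inE uU hin (negbTE hu).
rewrite hin muln1 /=; case: ltnP => h.
  by rewrite subnK //; apply: outdeg_to_le.
(* The outdegree is exactly [k.+1] here and the charge is 0; at most one edge goes to [X], and
   [1 <= k]. *)
by apply: leq_trans (hstar u uU _) _; lia.
Qed.

(** * The three stages of repair: matching, stars, single edges *)

Variable e : rel V.
Hypothesis e_irr : forall v, ~~ e v v.
Hypothesis e_min : forall v, indeg e v <= k \/ outdeg e v <= k.

Lemma tight_eq v : v \in tight e -> (indeg e v == k) || (outdeg e v == k).
Proof. by rewrite inE => /andP[h1 h2]; case: (e_min v) => h; lia. Qed.

Lemma repaired_step (T0 U S : {set V}) F G :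
  (forall v, v \in T0 :\: U -> repaired e F v) ->
  (forall v, v \in S -> repaired e G v) ->
  forall v, v \in T0 :\: (U :\: S) -> repaired e (F :|: G) v.
Proof.
move=> hF hG v; rewrite !inE negb_and negbK => /andP[/orP[vS|vU] vT].
  by apply: repaired_mono (hG v vS); apply: subsetUr.
by apply: repaired_mono (hF v _); [apply: subsetUl | rewrite inE vU].
Qed.

(** A maximal matching is encoded by an inclusion-minimal set [U] of unrepaired vertices: an edge
    violating the last clause would allow both of its ends to leave [U] at the cost of one edge. The
    neighbour recorded for each repaired vertex later yields a strict inequality. *)
Lemma matching_stage :
  exists (U : {set V}) F,
    [/\ U \subset tight e,
        forall v, v \in tight e :\: U -> repaired e F v,
        2 * #|F| <= #|tight e :\: U|,
        forall v, v \in tight e :\: U ->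
          exists2 w, w \in tight e :\: U & e v w || e w v &
        forall u v, u \in out_eq e U -> v \in in_eq e U -> ~~ e u v].
Proof.
set T := tight e.
pose good (U : {set V}) := [&& U \subset T,
  [exists F : {set V * V}, [forall v in T :\: U, repaired e F v] &&
                             (2 * #|F| <= #|T :\: U|)]
  & [forall v in T :\: U, exists w in T :\: U, e v w || e w v]].
have goodT : good T.
  apply/and3P; split=> //; last by apply/forall_inP => v; rewrite setDv inE.
  apply/existsP; exists set0; rewrite setDv !cards0 andbT.
  by apply/forall_inP => v; rewrite inE.
have [U /minsetP[/and3P[UT /existsP[F /andP[/forall_inP hF cF]] hN] minU] _] :=
  minset_exists goodT.
move/forall_inP: hN => hN; exists U, F; split=> //.
  by move=> v vU; have /exists_inP[w] := hN v vU; exists w.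
move=> u v; rewrite !inE => /andP[uU /eqP hu] /andP[vU /eqP hv].
apply/negP => euv.
have uv : u != v by apply: contraL euv => /eqP ->; apply: e_irr.
have sUv : [set u; v] \subset U by apply/subsetP => x /set2P[] ->.
have cardD : #|T :\: (U :\: [set u; v])| = #|T :\: U| + 2.
  have := cardsD T (U :\: [set u; v]); have := cardsD T U.
  rewrite !(setIidPr _) //; last exact: subset_trans (subsetDl _ _) UT.
  rewrite (cardsD U) (setIidPr sUv) cards2 uv /=.
  by have := subset_leq_card UT; have := subset_leq_card sUv; rewrite cards2 uv;
     lia.
have goodU' : good (U :\: [set u; v]).
  apply/and3P; split; first exact: subset_trans (subsetDl _ _) UT.
    apply/existsP; exists (F :|: [set (u, v)]); apply/andP; split.
      apply/forall_inP; apply: repaired_step => // x /set2P[] ->.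
        by apply: (repaired_tail euv) => //; rewrite inE.
      by apply: (repaired_head euv) => //; rewrite inE.
    rewrite cardD; apply: leq_trans (leq_mul (leqnn 2) (leq_card_setU _ _)) _.
    by rewrite cards1 mulnDr leq_add2r.
  have inD x : x \in [set u; v] -> x \in T :\: (U :\: [set u; v]).
    by move=> xS; rewrite in_setD (subsetP UT) ?(subsetP sUv) // in_setD xS.
  apply/forall_inP => x; rewrite in_setD in_setD negb_and negbK => /andP[].
  case/orP=> [/set2P[] -> _|xU xT].
  - by apply/exists_inP; exists v; rewrite ?euv // inD // !inE eqxx orbT.
  - by apply/exists_inP; exists u; rewrite ?euv ?orbT // inD // !inE eqxx.
  have /hN/exists_inP[w wU ew] : x \in T :\: U by rewrite in_setD xU.
  apply/exists_inP; exists w => //; move: wU; rewrite !in_setD.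
  by case/andP=> /negbTE -> ->; rewrite andbF.
have := minU _ goodU' (subsetDl _ _) => /setP/(_ u).
by rewrite !inE eqxx uU.
Qed.

(** Again [U] is taken minimal; a centre of degree [k.+1] with two suitable neighbours in [U] would
    let three vertices leave at the cost of two edges. *)
Lemma star_stage (U1 : {set V}) F1 :
  U1 \subset tight e ->
  (forall v, v \in tight e :\: U1 -> repaired e F1 v) ->
  exists (U : {set V}) F,
    [/\ U \subset U1,
        forall v, v \in tight e :\: U -> repaired e F v,
        3 * #|F| <= 3 * #|F1| + 2 * #|U1 :\: U|,
        forall v, v \in U -> outdeg e v = k.+1 ->
          outdeg_to e (in_eq e U) v <= 1 &
        forall v, v \in U -> indeg e v = k.+1 ->
          outdeg_to (conv e) (out_eq e U) v <= 1].
Proof.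
move=> U1T hF1; set T := tight e.
pose good (U : {set V}) := (U \subset U1) &&
  [exists F : {set V * V}, [forall v in T :\: U, repaired e F v] &&
             (3 * #|F| <= 3 * #|F1| + 2 * #|U1 :\: U|)].
have good1 : good U1.
  apply/andP; split=> //; apply/existsP; exists F1; rewrite leq_addr andbT.
  exact/forall_inP.
have [U /minsetP[/andP[UU1 /existsP[F /andP[/forall_inP hF cF]]] minU] _] :=
  minset_exists good1.
(* Stated without orientation, so that it excludes both out-stars and in-stars. *)
have no_star v x y p q : v \in U -> x \in U -> y \in U ->
    v != x -> v != y -> x != y ->
    ~ (forall w, w \in [set v; x; y] -> repaired e [set p; q] w).
  move=> vU xU yU vx vy xy hG.
  have sU : [set v; x; y] \subset U.
    by apply/subsetP => w; rewrite !inE -orbA => /or3P[] /eqP ->.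
  have c3 : #|[set v; x; y]| = 3.
    by rewrite setUC cardsU1 cards2 vx !inE negb_or ![y == _]eq_sym vy xy.
  have goodU' : good (U :\: [set v; x; y]).
    apply/andP; split; first exact: subset_trans (subsetDl _ _) UU1.
    apply/existsP; exists (F :|: [set p; q]); apply/andP; split.
      by apply/forall_inP; apply: repaired_step.
    have c2 : #|[set p; q]| <= 2 by rewrite cards2; case: (_ != _).
    apply: leq_trans (leq_mul (leqnn 3) (leq_card_setU _ _)) _.
    rewrite mulnDr; apply: leq_trans (leq_add cF (leq_mul (leqnn 3) c2)) _.
    have := cardsD U1 (U :\: [set v; x; y]); have := cardsD U1 U.
    rewrite !(setIidPr _) //; last exact: subset_trans (subsetDl _ _) UU1.
    rewrite (cardsD U) (setIidPr sU) c3.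
    by have := subset_leq_card UU1; have := subset_leq_card sU; rewrite c3; lia.
  have := minU _ goodU' (subsetDl _ _) => /setP/(_ v).
  by rewrite !inE eqxx vU.
have neqe x y : e x y -> x != y.
  by move=> exy; apply: contraL exy => /eqP ->; apply: e_irr.
exists U, F; split=> // v vU hv; rewrite leqNgt; apply/negP => /card_gt1P.
  move=> [x [y [+ + xy]]]; rewrite !inE.
  move=> /andP[/andP[xU /eqP hx] ex] /andP[/andP[yU /eqP hy] ey].
  apply: (no_star v x y (v, x) (v, y)) => //; try exact: neqe.
  move=> w; rewrite !inE -orbA => /or3P[] /eqP ->.
  - by apply: (repaired_out_star xy ex ey) => //; rewrite !inE eqxx ?orbT.
  - by apply: (repaired_head ex) => //; rewrite !inE eqxx.
  - by apply: (repaired_head ey) => //; rewrite !inE eqxx orbT.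
move=> [x [y [+ + xy]]]; rewrite !inE.
move=> /andP[/andP[xU /eqP hx] ex] /andP[/andP[yU /eqP hy] ey].
apply: (no_star v x y (x, v) (y, v)) => //; try by rewrite eq_sym neqe.
move=> w; rewrite !inE -orbA => /or3P[] /eqP ->.
- by apply: (repaired_in_star xy ex ey) => //; rewrite !inE eqxx ?orbT.
- by apply: (repaired_tail (ex : e x v)) => //; rewrite !inE eqxx.
- by apply: (repaired_tail (ey : e y v)) => //; rewrite !inE eqxx orbT.
Qed.

Lemma single_repair v : v \in tight e -> exists p, repaired e [set p] v.
Proof.
move=> vT; have := vT; rewrite inE => /andP[hi ho].
case/orP: (tight_eq vT) => /eqP hv.
  have /card_gt0P[w] : 0 < indeg e v by lia.
  rewrite inE => ewv; exists (w, v).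
  by apply: (repaired_head (ewv : e w v)); rewrite ?inE.
have /card_gt0P[w] : 0 < outdeg e v by lia.
by rewrite inE => evw; exists (v, w); apply: (repaired_tail evw); rewrite ?inE.
Qed.

Lemma single_stage (U : {set V}) : U \subset tight e ->
  exists2 F : {set V * V}, #|F| <= #|U| & forall v, v \in U -> repaired e F v.
Proof.
move=> /subsetP UT.
(* The default [(v, v)] is never reached for [v] in [U], since a tight vertex has a repairing
   edge. *)
pose f v := odflt (v, v) [pick p | repaired e [set p] v].
exists (f @: U); first exact: leq_imset_card.
move=> v vU; have hf : repaired e [set f v] v.
  have [p hp] := single_repair (UT v vU); rewrite /f.
  by case: pickP => [//|/(_ p)]; rewrite hp.
by apply: repaired_mono hf; rewrite sub1set imset_f.
Qed.

(** * Summation of the local inequalities *)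

Lemma exists_repair : exists F : {set V * V},
  (forall v, repaired e F v) /\ (k.*2.+1 * #|F| <= (\sum_v outdeg e v).*2).
Proof.
have [U1 [F1 [U1T hF1 cF1 hN hM]]] := matching_stage.
have [U [F2 [UU1 hF2 cF2 hout hin]]] := star_stage U1T hF1.
have UT := subset_trans UU1 U1T.
have [F3 cF3 hF3] := single_stage UT.
set T := tight e in U1T hF1 cF1 hN hF2 UT.
exists (F2 :|: F3); split.
  move=> v; case: (boolP (v \in T)) => [vT|].
    have [vU|vU] := boolP (v \in U).
      by apply: repaired_mono (hF3 v vU); apply: subsetUr.
    by apply: repaired_mono (hF2 v _); rewrite ?subsetUl // inE vU.
  rewrite inE negb_and -!ltnNge => h.
  apply: (@repaired_mono _ set0); first exact: sub0set.
  have full e' : outdeg (remove e' set0) v <= outdeg e' v.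
    by apply/subset_leq_card/subsetP => w; rewrite !inE /remove => /andP[].
  case/orP: h => h; apply/orP; [left|right]; apply: leq_ltn_trans h => //.
  rewrite indeg_remove (_ : swap_pairs set0 = set0) ?full //.
  by apply/setP => p; rewrite !inE.
set P := T :\: U1; set Q := U1 :\: U.
have [/subsetP sUT /subsetP sUU1] := (UT, UU1).
have UQ : U :|: Q = U1 by rewrite /Q setDE setUIr setUCr setIT; apply/setUidPr.
have b1 : k * #|in_eq e U :&: out_eq e U| <= \sum_v charge e U Q v.
  apply: charge_bound => // [v /sUT/tight_eq //|u v].
  rewrite UQ => hu; rewrite inE => /andP[vU hv]; apply: hM => //.
  by rewrite inE sUU1.
have b2 : k * #|in_eq e U :&: out_eq e U| <= \sum_v charge (conv e) U Q v.
  rewrite setIC; apply: (@charge_bound (conv e)) => //.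
  - by apply/subsetP => v /sUT; rewrite !inE andbC.
  - by move=> v /sUT/tight_eq; rewrite orbC.
  move=> u v; rewrite UQ => hu; rewrite inE => /andP[vU hv]; apply: hM => //.
  by rewrite inE sUU1.
(* The weights 6, 4, 3 are six times the costs 1, 2/3, 1/2 in edges per vertex of [U], [Q], [P]. The
   factor 3 on the charges makes [b1] and [b2] together cancel the last term after summation. *)
have pointwise v :
    k * k.*2.+1 * (6 * (v \in U) + 4 * (v \in Q) + 3 * (v \in P)) +
    3 * (charge e U Q v + charge (conv e) U Q v) <=
    6 * k * (outdeg e v + indeg e v) +
    6 * k * (v \in in_eq e U :&: out_eq e U).
  rewrite /charge -/(indeg e v) -/(outdeg e v).
  have -> : (v \in P) = (v \in T) && (v \notin U1) by rewrite inE andbC.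
  have -> : (v \in Q) = (v \in U1) && (v \notin U) by rewrite inE andbC.
  have -> : indeg (conv e) v = outdeg e v by [].
  have le1 := outdeg_to_le e (in_eq e U) v.
  have le2 : outdeg_to (conv e) (in_eq (conv e) U) v <= indeg e v.
    exact: outdeg_to_le.
  have [vU|vU] := boolP (v \in U).
    have := sUT v vU; rewrite !inE (sUU1 v vU) vU !andbF /= => /andP[hi ho].
    by rewrite muln1 !muln0 !addn0; apply: unrepaired_charge_le (tight_eq _);
       rewrite ?sUT.
  have -> : (v \in in_eq e U :&: out_eq e U) = false.
    by rewrite !inE (negbTE vU).
  have [vU1|vU1] := boolP (v \in U1).
    have := subsetP U1T v vU1; rewrite inE => /andP[hi ho].
    rewrite andbF !muln0 muln1 add0n !addn0.
    by apply: star_charge_le (tight_eq _) => //; apply: (subsetP U1T).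
  (* Outside [T] no weight is due, and the charges are at most the degrees, so [3 <= 6 * k]
     suffices. *)
  rewrite /= andbT !muln0 !add0n addn0; have [vT|vT] := boolP (v \in T);
    last by nia.
  have vP : v \in T :\: U1 by rewrite inE vU1.
  (* The neighbour [w] lies outside [U], so the edge joining it to [v] is not counted in the
     charges; their sum is strictly below the sum of the degrees. *)
  have [w wP] := hN v vP; have wU : w \notin U.
    by move: wP; rewrite inE => /andP[wU1 _]; apply: contra wU1; apply: sUU1.
  have wX e' : w \notin in_eq e' U by rewrite inE (negbTE wU).
  have := vT; rewrite inE => /andP[hi ho].
  rewrite muln1 => /orP ew; apply: matching_charge_le => //.
  case: ew => ew; first by have := outdeg_to_lt ew (wX e); lia.
  suff : outdeg_to (conv e) (in_eq (conv e) U) v < indeg e v by lia.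
  exact: (@outdeg_to_lt _ (conv e) _ _ w).
have cardE (A : {set V}) : #|A| = \sum_v (v \in A : nat).
  by rewrite -sum1_card big_mkcond; apply: eq_bigr => v _; case: (v \in A).
have := @leq_sum _ (index_enum V) xpredT _ _ (fun v _ => pointwise v).
rewrite !(big_split, =^~ big_distrr) /= -!cardE big1_eq sum_indeg.
have [+ _] := leq_card_setU F2 F3; move: b1 b2 cF1 cF2 cF3.
rewrite -/P -/Q.
set m := \sum_v outdeg e v; set C := #|_ :&: _|.
set s1 := \sum_v _; set s2 := \sum_v _.
set f := #|_ :|: _|; set f1 := #|F1|; set f2 := #|F2|; set f3 := #|F3|.
move=> b1 b2 c1 c2 c3 cf total.
(* Combines [f <= f2 + f3], [f3 <= #|U|], [3 * f2 <= 3 * f1 + 2 * #|Q|] and [2 * f1 <= #|P|]. *)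
have weights : 6 * f <= 6 * #|U| + 4 * #|Q| + 3 * #|P| by lia.
have : k * (k.*2.+1 * (6 * #|U| + 4 * #|Q| + 3 * #|P|)) <= k * (12 * m) by lia.
rewrite leq_pmul2l // => h.
suff : k.*2.+1 * (6 * f) <= 12 * m by lia.
by apply: leq_trans h; rewrite leq_mul2l weights orbT.
Qed.

End Repair.

(** * Return to digraphs and rational numbers *)

Import Order.TTheory GRing.Theory Num.Theory.
Local Open Scope ring_scope.

Theorem theorem10 (k : nat) (hk : (1 <= k)%N) (V : finType) (D : digraph V)
    (hD : in_D k k D) (m : nat) (hm : #|edges D| = m) :
  exists H : digraph V,
    [/\ subgraph H D,
        in_D (k - 1) (k - 1) H &
        (2%:R * k%:R - 1) * m%:R / (2%:R * k%:R + 1) <= #|edges H|%:R :> rat].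
Proof.
pose e : rel V := fun x y => (x, y) \in edges D.
have [F [hF cF]] := exists_repair hk (@loopless V D : forall v, ~~ e v v) hD.
have noloop v : (v, v) \notin edges D :\: F.
  by rewrite inE (negbTE (loopless D v)) andbF.
exists (Digraph noloop); split; first exact: subsetDl.
  move=> v; have := hF v; rewrite /repaired.
  have -> : indeg (remove e F) v = indegree (Digraph noloop) v.
    by apply: eq_card => u; rewrite !inE andbC.
  have -> : outdeg (remove e F) v = outdegree (Digraph noloop) v.
    by apply: eq_card => u; rewrite !inE andbC.
  by case/orP => h; [left | right]; lia.
rewrite sum_outdeg hm in cF.
have hcard : (m <= #|edges D :\: F| + #|F|)%N.
  by rewrite cardsD -hm; have := subset_leq_card (subsetIr (edges D) F); lia.
(* This is [(2k - 1) m <= (2k + 1) #|edges H|] with [m] added to both sides, which avoids truncated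
   subtraction. *)
have main : ((2 * k) * m <= (2 * k + 1) * #|edges D :\: F| + m)%N by nia.
have pos : 0 < 2%:R * k%:R + 1 :> rat.
  by rewrite ltr_wpDl // mulr_ge0 ?ler0n.
rewrite ler_pdivrMr //; move: main; rewrite -(ler_nat rat).
rewrite !(natrD, natrM) /=.
set a := k%:R; set b := m%:R; set c := #|_|%:R; lra.
Qed.
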